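(* Let $x,y\in\mathcal{S}$ (with $p_x>0$ for the first formula). The influence functions for the partial quantile index and the probability of comparison are given by $$IF_{\tau_x}(y,F)=\frac{1\{y\preccurlyeq x\}-\tau_x1\{y\preccurlyeq x\ \cup\ y\succcurlyeq x\}}{p_x}$$ and $$IF_{p_x}(y,F)=1\{y\preccurlyeq x\ \cup\ y\succcurlyeq x\}-p_x.$$
   Context: $X$ is a random variable with distribution $F$ on a set $\mathcal{S}$ with a partial order $\preccurlyeq$ ($x\succcurlyeq y$ means $y\preccurlyeq x$). $\mathcal{C}(x)=\{z\in\mathcal{S}:z\succcurlyeq x\text{ or }z\preccurlyeq x\}$; $p_x=p_x(F)=P(X\in\mathcal{C}(x))$; $\tau_x=\tau_x(F)=P(X\preccurlyeq x\mid X\in\mathcal{C}(x))$, viewed as functionals of the distribution. For $y\in\mathcal{S}$ and $\varepsilon\in(0,1)$, $F_\varepsilon=\varepsilon\delta_y+(1-\varepsilon)F$ is the contaminated distribution. The influence function of a functional $\theta$ at $F$ and $y$ is $IF_\theta(y,F)=\lim_{\varepsilon\to0}\frac{\theta(F_\varepsilon)-\theta(F)}{\varepsilon}$. The indicator $1\{y\preccurlyeq x\cup y\succcurlyeq x\}$ equals $1$ iff $y\preccurlyeq x$ or $y\succcurlyeq x$. *)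

(* Defs.v *)
From HB Require Import structures.
From mathcomp Require Import all_boot all_order all_algebra.
From mathcomp Require Import all_classical all_reals all_analysis.
From mathcomp Require Import wochoice.

Set Implicit Arguments.
Unset Strict Implicit.
Unset Printing Implicit Defensive.

Import Order.TTheory GRing.Theory Num.Theory.
Import numFieldNormedType.Exports.

Local Open Scope classical_set_scope.
Local Open Scope ring_scope.

Section comparability.
Context {d : measure_display} {S : measurableType d} {R : realType}.
Variable le : rel S.

Definition lower_section (x : S) : set S := [set z | le z x].

Definition upper_section (x : S) : set S := [set z | le x z].

Definition comparable_set (x : S) : set S := [set z | le x z || le z x].

(* P(A | B), with the junk value 0 when P(B) = 0. *)
Definition cond_prob (F : probability S R) (A B : set S) : R :=
  fine (F (A `&` B)) / fine (F B).

Definition comparison_prob (x : S) (F : probability S R) : R :=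
  fine (F (comparable_set x)).

Definition partial_quantile_index (x : S) (F : probability S R) : R :=
  cond_prob F (lower_section x) (comparable_set x).

End comparability.

Section clip.
Context {R : realType}.

Lemma clip01_ge0 (e : R) : 0 <= Num.max 0 (Num.min 1 e).
Proof. by rewrite le_max lexx. Qed.

Lemma clip01_le1 (e : R) : Num.max 0 (Num.min 1 e) <= 1.
Proof. by rewrite ge_max ler01 ge_min lexx. Qed.

(* Projection of the real line onto [0, 1]; it lets a family indexed by
   0 <= e <= 1 be written as a function of a real variable. *)
Definition clip01 (e : R) : {i01 R} := Itv01 (clip01_ge0 e) (clip01_le1 e).

Lemma clip01_id (e : R) : 0 <= e <= 1 -> (clip01 e)%:num = e.
Proof. by case/andP=> e0 e1 /=; rewrite (min_idPr e1) (max_idPr e0). Qed.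

End clip.

Section contamination.
Context {d : measure_display} {S : measurableType d} {R : realType}.

Section contaminated.
Variables (e : {i01 R}) (y : S) (F : probability S R).

Definition contaminated : set S -> \bar R :=
  measure_add (mscale e%:num%:nng \d_y) (mscale (1 - e%:num)%:nng F).

HB.instance Definition _ := Measure.on contaminated.

Lemma contaminatedE (A : set S) :
  contaminated A = (e%:num%:E * \d_y A + (1 - e%:num)%:E * F A)%E.
Proof. by rewrite /contaminated measure_addE. Qed.

Let contaminated_setT : contaminated setT = 1%E.
Proof.
by rewrite contaminatedE diracT probability_setT !mule1 -EFinD addrC subrK.
Qed.

HB.instance Definition _ :=
  Measure_isProbability.Build _ _ _ contaminated contaminated_setT.

End contaminated.

Variable theta : probability S R -> R.

Definition influence_quotient (y : S) (F : probability S R) (e : R) : R :=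
  (theta (contaminated (clip01 e) y F) - theta F) / e.

(* The contamination weight lies in (0, 1), so the limit is one-sided.
   [lim] is total: existence of the limit is [has_influence]. *)
Definition has_influence (y : S) (F : probability S R) : Prop :=
  cvg (influence_quotient y F e @[e --> 0^'+]).

Definition influence_function (y : S) (F : probability S R) : R :=
  lim (influence_quotient y F e @[e --> 0^'+]).

End contamination.

(* Main.v *)
(* On [0, 1] contamination moves the mass of A linearly, at rate
   1_A(y) - F(A).  The comparison probability is such a mass, so its difference
   quotient is constant.  The partial quantile index is a ratio N/D of the masses
   of A `&` B and B.  Since N_e D - N D_e = e (1_(A `&` B)(y) D - N 1_B(y)), its
   difference quotient is (1_(A `&` B)(y) - (N/D) 1_B(y)) / D_e, and D_e tends
   to D > 0. *)

Require Import Defs.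
From HB Require Import structures.
From mathcomp Require Import all_boot all_order all_algebra.
From mathcomp Require Import all_classical all_reals all_analysis.
From mathcomp Require Import wochoice.
From mathcomp Require Import ring.

Import Order.TTheory GRing.Theory Num.Theory.
Import numFieldNormedType.Exports.

Local Open Scope classical_set_scope.
Local Open Scope ring_scope.

Section influence.
Context {d : measure_display} {S : measurableType d} {R : realType}.
Implicit Types (F : probability S R) (A B : set S) (y : S).

Lemma fine_contaminated (e : R) y F A : 0 <= e <= 1 -> measurable A ->
  fine (contaminated (clip01 e) y F A) = e * \1_A y + (1 - e) * fine (F A).
Proof.
move=> e01 mA; rewrite contaminatedE (clip01_id e01) diracE.
by rewrite -[F A]fineK ?fin_num_measure // -!EFinM -EFinD /= indicE.
Qed.

(** A right-sided limit at 0 only sees small positive [e], so a closed form [g] valid on (0, 1),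
    where [clip01] is the identity, decides both existence and value of the limit. *)
Lemma influenceP (theta : probability S R -> R) y F (g : R -> R) (l : R) :
  (forall e, 0 < e < 1 -> influence_quotient theta y F e = g e) ->
  g e @[e --> 0^'+] --> l ->
  has_influence theta y F /\ influence_function theta y F = l.
Proof.
move=> qE gl.
suff ql : influence_quotient theta y F e @[e --> 0^'+] --> l.
  by split; [apply/cvg_ex; exists l | exact: cvg_lim].
apply: cvg_trans gl; apply: near_eq_cvg; near=> e.
apply/esym/qE/andP; split; near: e.
  exact: nbhs_right_gt.
exact: nbhs_right_lt.
Unshelve. all: by end_near. Qed.

Lemma influence_prob y F A : measurable A ->
  let theta (G : probability S R) := fine (G A) in
  has_influence theta y F /\
  influence_function theta y F = \1_A y - fine (F A).
Proof.
move=> mA theta; apply: influenceP (cvg_cst _) => e /andP[e0 e1].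
rewrite /influence_quotient /theta fine_contaminated ?(ltW e0) ?(ltW e1)//.
by field; rewrite gt_eqF.
Qed.

Lemma influence_cond_prob y F A B : measurable A -> measurable B ->
  0 < fine (F B) ->
  let theta G := cond_prob G A B in
  has_influence theta y F /\
  influence_function theta y F =
    (\1_(A `&` B) y - cond_prob F A B * \1_B y) / fine (F B).
Proof.
move=> mA mB FB0 theta.
(* For [e] in [0, 1] this is the contaminated mass of [B]; the affine formula, free of [clip01],
   makes sense for every real [e]. *)
pose D (e : R) := e * \1_B y + (1 - e) * fine (F B).
have DF : D e @[e --> 0^'+] --> fine (F B).
  (* The limit is written as [D 0], so that two-sided continuity of each factor at 0 gives the
     claim. *)
  have -> : fine (F B) = 0 * \1_B y + (1 - 0) * fine (F B).
    by rewrite mul0r subr0 mul1r add0r.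
  apply: cvg_at_right_filter; apply: cvgD.
    by apply: cvgM; [exact: cvg_id | exact: cvg_cst].
  apply: cvgM; last exact: cvg_cst.
  by apply: cvgB; [exact: cvg_cst | exact: cvg_id].
apply: (@influenceP _ _ _
    (fun e => (\1_(A `&` B) y - cond_prob F A B * \1_B y) / D e)).
  move=> e /andP[e0 e1].
  have De0 : 0 < D e.
    (* Strictness comes from the [F] part, as [e < 1] and [F B] has positive mass; the Dirac part
       may vanish. *)
    by rewrite ltr_wpDl ?mulr_gt0 ?subr_gt0// mulr_ge0 ?(ltW e0)// indicE.
  rewrite /influence_quotient /theta /cond_prob.
  rewrite !fine_contaminated ?(ltW e0) ?(ltW e1)//; last exact: measurableI.
  rewrite /D in De0 *.
  by field; rewrite !gt_eqF.
by apply: cvgM; [exact: cvg_cst | apply: cvgV => //; rewrite gt_eqF].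
Qed.

End influence.

Theorem lemma3 (d : measure_display) (S : measurableType d) (R : realType)
    (le : rel S) (le_order : partial_order le) (F : probability S R) (x y : S)
    (mlower : measurable (lower_section le x))
    (mupper : measurable (upper_section le x)) :
  (0 < comparison_prob le x F ->
     has_influence (partial_quantile_index le x) y F /\
     influence_function (partial_quantile_index le x) y F =
       ((le y x)%:R
          - partial_quantile_index le x F * (le y x || le x y)%:R)
       / comparison_prob le x F) /\
  (has_influence (comparison_prob le x) y F /\
   influence_function (comparison_prob le x) y F =
     (le y x || le x y)%:R - comparison_prob le x F).
Proof.
have CE : comparable_set le x = upper_section le x `|` lower_section le x.
  by apply/seteqP; split => z /= /orP.
have mC : measurable (comparable_set le x) by rewrite CE; exact: measurableU.
have CyE : \1_(comparable_set le x) y = (le y x || le x y)%:R :> R.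
  by rewrite indicE mem_setE /comparable_set /in_mem /= orbC.
have LyE : \1_(lower_section le x `&` comparable_set le x) y = (le y x)%:R :> R.
  (* Everything below [x] is comparable to [x], so the intersection collapses to the lower
     section. *)
  rewrite setIidl ?indicE ?mem_setE // CE; exact: subsetUr.
split=> [p0|].
- by rewrite -CyE -LyE; exact: influence_cond_prob.
- by rewrite -CyE; exact: influence_prob.
Qed.
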